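(* Any $\lambda\in H(e^4_2)$ with at most one negative entry is an eigenvalue vector of some matrix in $\mathcal{S}^{4,2}$, i.e. there exists $X\in\mathcal{S}^{4,2}$ whose eigenvalues, counted with multiplicity, are the entries $\lambda_1,\lambda_2,\lambda_3,\lambda_4$ of $\lambda$ (in some order).
   Context: $\mathcal{S}^{4,2}$ denotes the set of $4\times 4$ real symmetric matrices all of whose $2\times 2$ principal submatrices are positive semidefinite. For $\lambda\in\mathbb{R}^4$, $e^4_2(\lambda)=\sum_{1\le i<j\le 4}\lambda_i\lambda_j$ is the second elementary symmetric polynomial, and its closed hyperbolicity cone is $$H(e^4_2)=\{\lambda\in\mathbb{R}^4 : \text{for all } t\in\mathbb{R},\ e^4_2(\lambda+t(1,1,1,1))=0 \Rightarrow t\le 0\}.$$ *)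

(* Defs.v *)
From mathcomp Require Import all_boot all_order all_algebra.
From mathcomp Require Import reals.

Set Implicit Arguments.
Unset Strict Implicit.
Unset Printing Implicit Defensive.

Import Order.TTheory GRing.Theory Num.Theory.
Local Open Scope ring_scope.

Definition psdmx (R : realType) (n : nat) (A : 'M[R]_n) : Prop :=
  A^T = A /\ forall v : 'cV[R]_n, 0 <= (v^T *m A *m v) 0 0.

(* S^{n,k}: the k x k principal submatrices are indexed by the strictly
   increasing maps from 'I_k to 'I_n. *)
Definition locally_psd (R : realType) (n k : nat) (X : 'M[R]_n) : Prop :=
  X^T = X /\
  forall f : 'I_k -> 'I_n,
    (forall i j : 'I_k, (i < j)%N -> (f i < f j)%N) -> psdmx (mxsub f f X).

Definition esym2 (R : realType) (n : nat) (lam : 'rV[R]_n) : R :=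
  \sum_(i < n) \sum_(j < n | (i < j)%N) lam 0 i * lam 0 j.

(* Closed hyperbolicity cone of p in the direction of the all-ones vector. *)
Definition hyp_cone (R : realType) (n : nat) (p : 'rV[R]_n -> R)
    (lam : 'rV[R]_n) : Prop :=
  forall t : R, p (lam + const_mx t) = 0 -> t <= 0.

(* The roots of the characteristic polynomial of X, with multiplicity, are the
   entries of lam, in some order. *)
Definition eigenvalue_vector (R : realType) (n : nat) (X : 'M[R]_n)
    (lam : 'rV[R]_n) : Prop :=
  char_poly X = \prod_(i < n) ('X - (lam 0 i)%:P).

(* Main.v *)
Require Import Defs.
From mathcomp Require Import all_boot all_order all_algebra.
From mathcomp Require Import reals ring lra.

Set Implicit Arguments.
Unset Strict Implicit.
Unset Printing Implicit Defensive.

Import Order.TTheory GRing.Theory Num.Theory.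
Local Open Scope ring_scope.

(** Write e_1, e_2 for the first two elementary symmetric functions of lam.
Since e_2(lam + t 1) = 6 t^2 + 3 e_1 t + e_2 has real roots, lam lies in the
hyperbolicity cone exactly when e_1 >= 0 and e_2 >= 0 (only the direct
implication is proved, [hyp_cone_esym2]).  Sort the entries as
a >= b >= c >= e; having at most one negative entry means c >= 0.

If e >= 0, a diagonal matrix works.  Otherwise put e = -d with d > 0.  Being
locally positive semidefinite only asks for X_ii >= 0 and X_ij^2 <= X_ii X_jj,
and two families of matrices suffice.

- If c >= d, all three nonnegative eigenvalues dominate d, and the matrix with
  these eigenvalues on the orthogonal basis of sign vectors of a 4 x 4 Hadamard
  matrix, with -d on the all-ones vector, has a constant diagonal that
  dominates every other entry ([realizable_hadamard]).

- If c < d, then e_1, e_2 >= 0 force a >= d, so that a and c lie on either side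
  of d.  On the boundary e_2 = 0 all 2 x 2 principal minors of X must vanish,
  which forces |X_ij| = v_i v_j with v_i^2 = X_ii; taking every off-diagonal
  sign negative gives X = 2 diag(v_i^2) - v v^T.  When v_1 = v_2, the vector
  (1, -1, 0, 0) is an eigenvector for the eigenvalue 2 v_1^2, so its eigenvalue
  can be raised freely by adding a multiple of a positive semidefinite rank one
  matrix, which preserves local positive semidefiniteness
  ([realizable_twin_rows]).  Hence it is enough to lower b to the value g / s
  at which e_2 vanishes, where g = d (a + c) - a c and s = a + c - d, and to
  solve for v; the discriminant of the quadratic equation giving v_3^2 and
  v_4^2 has the sign of (a - d) (d - c), which is why the two eigenvalues kept
  fixed must straddle d ([realizable_straddle]). *)

(** * Local positive semidefiniteness and characteristic polynomials *)

Lemma binary_form_ge0 (R : realFieldType) (a b c x y : R) :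
  0 <= a -> 0 <= c -> b ^+ 2 <= a * c ->
  0 <= a * x ^+ 2 + b * x * y *+ 2 + c * y ^+ 2.
Proof.
move=> a0 c0 bac; have [a_gt0|] := ltP 0 a; last first.
  move=> a_le0; have aE : a = 0 by lra.
  move: bac; rewrite aE mul0r => b2; have bE : b = 0.
    by apply/eqP; rewrite -sqrf_eq0 eq_le b2 sqr_ge0.
  rewrite bE !mul0r mul0rn !add0r; exact: mulr_ge0 c0 (sqr_ge0 y).
rewrite -(pmulr_rge0 _ a_gt0).
have -> : a * (a * x ^+ 2 + b * x * y *+ 2 + c * y ^+ 2) =
    (a * x + b * y) ^+ 2 + (a * c - b ^+ 2) * y ^+ 2 by ring.
by rewrite addr_ge0 ?sqr_ge0 // mulr_ge0 ?sqr_ge0 // subr_ge0.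
Qed.

Lemma locally_psd2_of_minors (R : realType) (n : nat) (X : 'M[R]_n) :
  X^T = X -> (forall i, 0 <= X i i) ->
  (forall i j : 'I_n, (i < j)%N -> X i j ^+ 2 <= X i i * X j j) ->
  locally_psd 2 X.
Proof.
move=> Xsym Xdiag Xminor; split=> // f f_incr; split.
  by rewrite trmx_mxsub Xsym.
move=> v; rewrite mxE 2!big_ord_recl big_ord0 !mxE !(big_ord_recl, big_ord0) !mxE.
have := Xminor _ _ (f_incr ord0 (lift ord0 ord0) isT).
set j := lift ord0 ord0; set i := ord0.
have -> : X (f j) (f i) = X (f i) (f j) by rewrite -[in LHS]Xsym mxE.
move=> /(@binary_form_ge0 R _ _ _ (v i 0) (v j 0) (Xdiag _) (Xdiag _)).
by congr (0 <= _); ring.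
Qed.

Definition mx4 (R : nzRingType) (rows : seq (seq R)) : 'M[R]_4 :=
  \matrix_(i, j) nth 0 (nth [::] rows i) j.

(** Laplace expansion along the first two rows: complementary 2 x 2 minors. *)
Lemma det_mx4 (R : comNzRingType) (a11 a12 a13 a14 a21 a22 a23 a24
    a31 a32 a33 a34 a41 a42 a43 a44 : R) :
  \det (mx4 [:: [:: a11; a12; a13; a14]; [:: a21; a22; a23; a24];
    [:: a31; a32; a33; a34]; [:: a41; a42; a43; a44]]) =
  (a11 * a22 - a12 * a21) * (a33 * a44 - a34 * a43)
  - (a11 * a23 - a13 * a21) * (a32 * a44 - a34 * a42)
  + (a11 * a24 - a14 * a21) * (a32 * a43 - a33 * a42)
  + (a12 * a23 - a13 * a22) * (a31 * a44 - a34 * a41)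
  - (a12 * a24 - a14 * a22) * (a31 * a43 - a33 * a41)
  + (a13 * a24 - a14 * a23) * (a31 * a42 - a32 * a41).
Proof.
rewrite (expand_det_row _ ord0) !(big_ord_recl, big_ord0) /cofactor.
rewrite !(expand_det_row _ ord0) !(big_ord_recl, big_ord0) /cofactor.
rewrite !(expand_det_row _ ord0) !(big_ord_recl, big_ord0) /cofactor.
rewrite !det_mx11 !mxE /=.
ring.
Qed.

(** Symmetric matrices given by their upper triangle, row by row. *)
Definition sym_mx4 (R : nzRingType) (a11 a12 a13 a14 a22 a23 a24 a33 a34 a44 : R) :=
  mx4 [:: [:: a11; a12; a13; a14]; [:: a12; a22; a23; a24];
          [:: a13; a23; a33; a34]; [:: a14; a24; a34; a44]].

Lemma char_poly_mx4 (R : comNzRingType)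
    (a11 a12 a13 a14 a22 a23 a24 a33 a34 a44 : R) :
  char_poly_mx (sym_mx4 a11 a12 a13 a14 a22 a23 a24 a33 a34 a44) =
  sym_mx4 ('X - a11%:P) (- a12%:P) (- a13%:P) (- a14%:P)
          ('X - a22%:P) (- a23%:P) (- a24%:P)
          ('X - a33%:P) (- a34%:P) ('X - a44%:P).
Proof.
apply/matrixP=> -[[|[|[|[|//]]]] ilt] -[[|[|[|[|//]]]] jlt];
  by rewrite !mxE /= ?mulr1n ?mulr0n ?sub0r.
Qed.

Lemma locally_psd2_sym_mx4 (R : realType)
    (a11 a12 a13 a14 a22 a23 a24 a33 a34 a44 : R) :
  [/\ 0 <= a11, 0 <= a22, 0 <= a33 & 0 <= a44] ->
  [/\ a12 ^+ 2 <= a11 * a22, a13 ^+ 2 <= a11 * a33 & a14 ^+ 2 <= a11 * a44] ->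
  [/\ a23 ^+ 2 <= a22 * a33, a24 ^+ 2 <= a22 * a44 & a34 ^+ 2 <= a33 * a44] ->
  locally_psd 2 (sym_mx4 a11 a12 a13 a14 a22 a23 a24 a33 a34 a44).
Proof.
move=> [? ? ? ?] [? ? ?] [? ? ?]; apply: locally_psd2_of_minors.
- by apply/matrixP=> -[[|[|[|[|//]]]] ilt] -[[|[|[|[|//]]]] jlt]; rewrite !mxE.
- by move=> -[[|[|[|[|//]]]] ilt]; rewrite !mxE.
- by move=> -[[|[|[|[|//]]]] ilt] -[[|[|[|[|//]]]] jlt]; rewrite !mxE.
Qed.

(** * Explicit matrices with prescribed spectrum *)

Definition realizable (R : realType) (s : seq R) : Prop :=
  exists X : 'M[R]_4,
    locally_psd 2 X /\ char_poly X = \prod_(z <- s) ('X - z%:P).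

Lemma realizable_ge0 (R : realType) (a b c d : R) :
  0 <= a -> 0 <= b -> 0 <= c -> 0 <= d -> realizable [:: a; b; c; d].
Proof.
move=> a0 b0 c0 d0; exists (sym_mx4 a 0 0 0 b 0 0 c 0 d); split.
  by apply: locally_psd2_sym_mx4; split=> //; rewrite expr0n mulr_ge0.
rewrite /char_poly char_poly_mx4 det_mx4 !big_cons big_nil; ring.
Qed.

(** The matrix is (a h_1 h_1^T + b h_2 h_2^T + c h_3 h_3^T - d h_0 h_0^T) / 4 for
the pairwise orthogonal vectors h_0 = (1, 1, 1, 1), h_1 = (1, 1, -1, -1),
h_2 = (1, -1, 1, -1) and h_3 = (1, -1, -1, 1).  Its off-diagonal entries x take
three values; m - x is half the sum of two of a, b, c, and m + x is half the
difference between the third and d. *)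
Lemma realizable_hadamard (R : realType) (a b c d : R) :
  0 <= d -> d <= a -> d <= b -> d <= c -> realizable [:: a; b; c; - d].
Proof.
move=> d0 da db dc.
pose m := (a + b + c - d) / 4.
pose p := (a - b - c - d) / 4; pose q := (b - a - c - d) / 4.
pose r := (c - a - b - d) / 4.
exists (sym_mx4 m p q r m r q m p m); split.
  have m0 : 0 <= m by rewrite /m; lra.
  have sqr_le x : - m <= x -> x <= m -> x ^+ 2 <= m * m.
    by move=> *; nra.
  by apply: locally_psd2_sym_mx4; split=> //; apply: sqr_le; rewrite /m /p /q /r; lra.
rewrite /char_poly char_poly_mx4 det_mx4 !big_cons big_nil.
have -> : a = m + p - q - r by rewrite /m /p /q /r; field.
have -> : b = m - p + q - r by rewrite /m /p /q /r; field.
have -> : c = m - p - q + r by rewrite /m /p /q /r; field.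
have -> : d = - (m + p + q + r) by rewrite /m /p /q /r; field.
ring.
Qed.

(** With v = (u, u, p, q), the matrix is 2 diag(v_i^2) - v v^T plus
b / 2 - u^2 times the Gram matrix of (1, -1, 0, 0), an eigenvector whose
eigenvalue becomes b.  The hypotheses on x, y, z say that they are the
eigenvalues on the orthogonal complement of that vector; the inequality
between u^2 and b / 2 says that the added term is positive semidefinite. *)
Lemma realizable_twin_rows (R : realType) (b x y z u p q : R) :
  0 <= b -> u ^+ 2 <= b / 2 ->
  x + y + z = p ^+ 2 + q ^+ 2 ->
  x * y + y * z + z * x = - 2 * u ^+ 2 * (p ^+ 2 + q ^+ 2) ->
  x * y * z = - 8 * u ^+ 2 * p ^+ 2 * q ^+ 2 ->
  realizable [:: b; x; y; z].
Proof.
move=> b0 ub e1 e2 e3.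
exists (sym_mx4 (b / 2) (- (b / 2)) (- (u * p)) (- (u * q))
  (b / 2) (- (u * p)) (- (u * q)) (p ^+ 2) (- (p * q)) (q ^+ 2)); split.
  apply: locally_psd2_sym_mx4; split; rewrite ?sqr_ge0 ?divr_ge0 ?ler0n //;
    by rewrite sqrrN -?expr2 ?lexx // exprMn ?lexx // ler_wpM2r ?sqr_ge0.
rewrite /char_poly char_poly_mx4 det_mx4 !big_cons big_nil.
set c := b / 2; have -> : b = c * 2 by rewrite /c; field.
have -> : ('X - x%:P) * (('X - y%:P) * (('X - z%:P) * 1)) =
   'X ^+ 3 - (x + y + z)%:P * 'X ^+ 2 + (x * y + y * z + z * x)%:P * 'X
   - (x * y * z)%:P :> {poly R} by ring.
rewrite e1 e2 e3; ring.
Qed.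

(** The squares of p and q are the roots of T^2 - s T + m, which are nonnegative
reals since the discriminant, s and m are nonnegative. *)
Lemma sum_prod_sqr (R : rcfType) (s m : R) :
  0 <= s -> 0 <= m -> 4 * m <= s ^+ 2 ->
  exists p q : R, p ^+ 2 + q ^+ 2 = s /\ p ^+ 2 * q ^+ 2 = m.
Proof.
move=> s0 m0 disc; pose r := Num.sqrt (s ^+ 2 - 4 * m).
have r2 : r ^+ 2 = s ^+ 2 - 4 * m by rewrite sqr_sqrtr // subr_ge0.
have r0 : 0 <= r by rewrite sqrtr_ge0.
have rs : r <= s by rewrite -(ler_pXn2r (n := 2)) ?nnegrE // r2; lra.
exists (Num.sqrt ((s + r) / 2)), (Num.sqrt ((s - r) / 2)).
rewrite !sqr_sqrtr; [|lra|lra]; split; first by field.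
have -> : (s + r) / 2 * ((s - r) / 2) = (s ^+ 2 - r ^+ 2) / 4 by field.
by rewrite r2; field.
Qed.

(** The parameters of [realizable_twin_rows] are forced: p^2 + q^2 = s by the
trace, 2 u^2 s = g by the second symmetric function, hence
p^2 q^2 = x y d s / (4 g) by the third.  Here g / s is the value that b takes
on the boundary e_2 = 0, so e_2 >= 0 gives 2 u^2 = g / s <= b. *)
Lemma realizable_straddle (R : realType) (b x y d : R) :
  0 < d -> 0 <= y -> y <= d -> d <= x -> 0 <= b ->
  d * (b + x + y) <= b * x + b * y + x * y -> realizable [:: b; x; y; - d].
Proof.
move=> d0 y0 yd dx b0 e2.
pose s := x + y - d; pose g := d * (x + y) - x * y.
have g0 : 0 < g by rewrite /g; nra.
have gsb : g <= b * s by rewrite /g /s; nra.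
have s0 : 0 < s by nra.
have [p [q [pqD pqM]]] : exists p q : R,
    p ^+ 2 + q ^+ 2 = s /\ p ^+ 2 * q ^+ 2 = x * y * d * s / (4 * g).
  apply: sum_prod_sqr; first exact: ltW.
    by rewrite divr_ge0 ?mulr_ge0 //; lra.
  have -> : 4 * (x * y * d * s / (4 * g)) = x * y * d * s / g.
    by field; rewrite gt_eqF.
  rewrite ler_pdivrMr // -subr_ge0.
  (* The discriminant factors: this is where y <= d <= x is needed. *)
  have -> : s ^+ 2 * g - x * y * d * s = s * ((x + y) * ((x - d) * (d - y))).
    by rewrite /s /g; ring.
  by rewrite !mulr_ge0 ?subr_ge0 //; lra.
pose u := Num.sqrt (g / (2 * s)).
have u2 : u ^+ 2 = g / (2 * s) by rewrite sqr_sqrtr // divr_ge0; lra.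
apply: (@realizable_twin_rows _ _ _ _ _ u p q) => //.
- by rewrite u2 ler_pdivrMr; lra.
- by rewrite pqD u2; rewrite /g; field; rewrite gt_eqF.
- rewrite -(mulrA (- 8 * u ^+ 2)) pqM u2; field; by rewrite !gt_eqF.
Qed.

Lemma sorted_realizable (R : realType) (a b c e : R) :
  b <= a -> c <= b -> e <= c -> 0 <= c ->
  0 <= a + b + c + e -> 0 <= a * b + a * c + a * e + b * c + b * e + c * e ->
  realizable [:: a; b; c; e].
Proof.
move=> ba cb ec c0 e1 e2.
have [e0|e_lt0] := lerP 0 e; first by apply: realizable_ge0 => //; lra.
have [d_le_c|c_lt_d] := lerP (- e) c.
  by rewrite -(opprK e); apply: realizable_hadamard; lra.
(* If a < d then a b + a c + b c <= a (a + b + c), which contradicts e_2 >= 0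
   unless a = b = c = 0, a case excluded by e_1 >= 0. *)
have a_ge : - e <= a by rewrite leNgt; apply/negP=> ae; nra.
suff [X [X1 X2]] : realizable [:: b; a; c; - (- e)].
  by exists X; split=> //; rewrite X2 opprK !big_cons big_nil; ring.
by apply: realizable_straddle; lra.
Qed.

(** * The hyperbolicity cone of the second elementary symmetric polynomial *)

(** Makes the invariance of [esym2] under permutation of the entries visible. *)
Lemma esym2_power_sums (R : realType) (n : nat) (lam : 'rV[R]_n) :
  esym2 lam *+ 2 = (\sum_i lam 0 i) ^+ 2 - \sum_i lam 0 i ^+ 2.
Proof.
apply/eqP; rewrite eq_sym subr_eq expr2 big_distrlr /= mulr2n.
have -> : esym2 lam + esym2 lam =
    esym2 lam + \sum_(i < n) \sum_(j < n | (j < i)%N) lam 0 i * lam 0 j.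
  congr (_ + _); rewrite /esym2 (exchange_big_dep predT) //=.
  by apply: eq_bigr => i _; apply: eq_bigr => j _; rewrite mulrC.
rewrite -!big_split /=; apply/eqP/eq_bigr => i _.
rewrite (bigID (fun j : 'I_n => (i < j)%N)) /= -addrA; congr (_ + _).
rewrite (bigD1 i) ?ltnn //= addrC; congr (_ + _).
by apply: eq_bigl => j; rewrite -leqNgt andbC -ltn_neqAle.
Qed.

Lemma esym2_shift (R : realType) (lam : 'rV[R]_4) (t : R) :
  esym2 (lam + const_mx t) = 6 * t ^+ 2 + 3 * (\sum_i lam 0 i) * t + esym2 lam.
Proof.
have := esym2_power_sums lam; have := esym2_power_sums (lam + const_mx t).
rewrite !(big_ord_recl, big_ord0) !mxE; lra.
Qed.

(** The largest root (r - 3 S) / 12 of t |-> e_2(lam + t 1), where r is the square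
root of the discriminant, must be nonpositive: 0 <= r <= 3 S, and then
r^2 <= 9 S^2 says that E >= 0. *)
Lemma hyp_cone_esym2 (R : realType) (lam : 'rV[R]_4) :
  hyp_cone (@esym2 R 4) lam -> 0 <= \sum_i lam 0 i /\ 0 <= esym2 lam.
Proof.
move=> hlam; set S := \sum_i _; set E := esym2 lam.
(* The discriminant is 3 times the sum of the squared differences. *)
have disc : 0 <= 9 * S ^+ 2 - 24 * E.
  have -> : 24 * E = 12 * (E *+ 2) by ring.
  rewrite /E esym2_power_sums /S !(big_ord_recl, big_ord0).
  set a := lam _ _; set b := lam _ _; set c := lam _ _; set d := lam _ _.
  have -> : forall x y : R, 9 * x - 12 * (x - y) = 3 * (4 * y - x) by move=> *; ring.
  rewrite mulr_ge0 //.
  have -> : 4 * (a ^+ 2 + (b ^+ 2 + (c ^+ 2 + (d ^+ 2 + 0)))) -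
      (a + (b + (c + (d + 0)))) ^+ 2 =
      (a - b) ^+ 2 + (a - c) ^+ 2 + (a - d) ^+ 2
      + (b - c) ^+ 2 + (b - d) ^+ 2 + (c - d) ^+ 2 by ring.
  by rewrite !addr_ge0 ?sqr_ge0.
pose r := Num.sqrt (9 * S ^+ 2 - 24 * E).
have r2 : r ^+ 2 = 9 * S ^+ 2 - 24 * E by rewrite sqr_sqrtr.
have r0 : 0 <= r by rewrite sqrtr_ge0.
have /hlam rS : esym2 (lam + const_mx ((r - 3 * S) / 12)) = 0.
  rewrite esym2_shift -/S -/E.
  have -> : E = (9 * S ^+ 2 - r ^+ 2) / 24 by rewrite r2; field.
  by field.
split; first lra.
by nra.
Qed.

Theorem corollary1p4 (R : realType) (lam : 'rV[R]_4)
    (hlam : hyp_cone (@esym2 R 4) lam)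
    (hneg : (#|[set i : 'I_4 | (lam 0 i < 0)%R]| <= 1)%N) :
  exists X : 'M[R]_4, locally_psd 2 X /\ eigenvalue_vector X lam.
Proof.
have [e1 e2] := hyp_cone_esym2 hlam.
pose vals := [seq lam 0 i | i <- enum 'I_4]; pose s := sort >=%R vals.
have sP : perm_eq s vals by rewrite perm_sort.
have over_s (T : Type) (idx : T) (op : Monoid.com_law idx) (F : R -> T) :
    \big[op/idx]_(i < 4) F (lam 0 i) = \big[op/idx]_(z <- s) F z.
  by rewrite (perm_big _ sP) big_map big_enum.
suff [X [Xpsd Xchar]] : realizable s.
  exists X; split=> //; rewrite /eigenvalue_vector Xchar.
  by rewrite (over_s _ _ _ (fun z => 'X - z%:P)).
have s_sorted : sorted >=%R s by apply: sort_sorted => x y; exact: le_total.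
have s_neg : (count (fun z => z < 0)%R s <= 1)%N.
  by move: hneg; rewrite (permP sP) count_map cardsE cardE size_filter enumT.
have s_size : size s = 4 by rewrite (perm_size sP) size_map size_enum_ord.
have p1 : \sum_i lam 0 i = \sum_(z <- s) z by exact: over_s.
have p2 : \sum_i lam 0 i ^+ 2 = \sum_(z <- s) z ^+ 2 by exact: over_s.
have e2E := esym2_power_sums lam; move: e1 e2 e2E; rewrite p1 p2.
move: s s_sorted s_neg s_size {sP over_s p1 p2} => [|a [|b [|c [|e []]]]] //=.
rewrite !big_cons !big_nil => /and4P[ba cb ec _] neg _ e1 e2 e2E.
have c0 : 0 <= c.
  rewrite leNgt; apply/negP=> c_lt0; move: neg.
  by rewrite c_lt0 (le_lt_trans ec c_lt0); case: (a < 0); case: (b < 0).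
apply: sorted_realizable => //; lra.
Qed.
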